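(* Let $n\ge 10$ be an integer with $n\equiv 1\pmod 3$. Then $R(K_n,\mathbb{Z}_3)=n+3$.
   Context: $K_m$ denotes the complete graph on $m$ vertices. For a finite simple graph $H$ whose number of edges $e(H)$ is divisible by $3$, the zero-sum Ramsey number $R(H,\mathbb{Z}_3)$ is the least integer $N$ such that every edge labeling $w\colon E(K_N)\to\mathbb{Z}_3$ admits a copy $H'$ of $H$ in $K_N$ (a not necessarily induced subgraph isomorphic to $H$) with $\sum_{e\in E(H')}w(e)=0$ in $\mathbb{Z}_3$. For $H=K_n$ the divisibility condition $3\mid\binom n2$ is equivalent to $n\equiv 0,1\pmod 3$. *)

(* Defs.v *)
From HB Require Import structures.
From mathcomp Require Import all_boot all_order all_algebra.
Set Implicit Arguments.
Unset Strict Implicit.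
Unset Printing Implicit Defensive.

Import GRing.Theory.

Record sgraph := SGraph {
  vertex :> finType;
  adj : rel vertex;
  adj_sym : symmetric adj;
  adj_irr : irreflexive adj
}.

Definition edges (G : sgraph) : {set {set G}} :=
  [set e | [exists x, exists y, adj x y && (e == [set x; y])]].

Fact complete_sym (m : nat) : symmetric (fun x y : 'I_m => x != y).
Proof. by move=> x y; rewrite eq_sym. Qed.

Fact complete_irr (m : nat) : irreflexive (fun x y : 'I_m => x != y).
Proof. by move=> x; rewrite eqxx. Qed.

Definition complete_graph (m : nat) : sgraph :=
  SGraph (@complete_sym m) (@complete_irr m).

Definition is_subgraph (G : sgraph) (V : {set G}) (E : {set {set G}}) : Prop :=
  E \subset edges G /\ {in E, forall e : {set G}, e \subset V}.

Definition graph_iso (H G : sgraph) (V : {set G}) (E : {set {set G}}) : Prop :=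
  exists f : H -> G,
    [/\ injective f, f @: [set: H] = V
      & [set f @: (e : {set H}) | e in edges H] = E].

Definition is_copy (H G : sgraph) (V : {set G}) (E : {set {set G}}) : Prop :=
  is_subgraph V E /\ graph_iso H V E.

(* An edge labeling of K_N is represented by a function on all sets of
   vertices; only its values on edges are ever used. *)
Definition zero_sum_arrow (H : sgraph) (N : nat) : Prop :=
  forall w : {set complete_graph N} -> 'Z_3,
    exists (V : {set complete_graph N}) (E : {set {set complete_graph N}}),
      is_copy H V E /\ (\sum_(e in E) w e = 0)%R.

(* R(H, Z_3) = N, for H with 3 %| #|edges H|. When 3 does not divide the number
   of edges, the constant labeling 1 shows that no N satisfies this. *)
Definition is_zero_sum_ramsey (H : sgraph) (N : nat) : Prop :=
  zero_sum_arrow H N /\ forall M : nat, zero_sum_arrow H M -> N <= M.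

(* Main.v *)
(* Deleting three vertices a, b, c from K_N, N = n + 3, leaves label sum
   D - (g ab + g bc + g ac), where g xy = w xy + d x + d y, d is the weighted
   degree and D the sum of all d x.  Since N = 1 mod 3, all weighted degrees of
   g are D, so one needs a triangle of g-sum D.

   If there is none and D <> 0, let G be the matrix of g.  Squares of nonzero
   elements of Z_3 are 1, so summing (triangle sum - D)^2 over the triangles on
   ab expresses the entries of G^2 through those of G; this gives
   (G^3)_aa = D for all a, hence tr G^3 = N D = D, whereas tr G^3 = 0 because
   ordered triangles come in triples of rotations.

   If D = 0, no triangle of g is monochromatic or rainbow, and an analysis of
   the three colour neighbourhoods of a vertex shows N <= 12.

   For the lower bound, label the edges of K_(n+2) by 1 or -1 so that all
   weighted degrees vanish: deleting a, b then leaves label sum -w ab <> 0. *)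
Require Import Defs.
From HB Require Import structures.
From mathcomp Require Import all_boot all_order all_algebra.
From mathcomp Require Import zify ring.
Set Implicit Arguments.
Unset Strict Implicit.
Unset Printing Implicit Defensive.

Import GRing.Theory.
Local Open Scope ring_scope.

(** * Arithmetic in Z_3 *)

Lemma Z3_three : 3%:R = 0 :> 'Z_3.
Proof. exact: val_inj. Qed.

Lemma Z3_natr1 m : m = 1 %[mod 3] -> m%:R = 1 :> 'Z_3.
Proof. by move=> e; apply: val_inj; rewrite Zp_nat /= e. Qed.

Lemma Z3_sqr (x : 'Z_3) : x != 0 -> x ^+ 2 = 1.
Proof. by move: x; case=> [[|[|[|]]]] //= ? ?; apply: val_inj. Qed.

Lemma Z3_cube (x : 'Z_3) : x ^+ 3 = x.
Proof. by move: x; case=> [[|[|[|]]]] //= ?; apply: val_inj. Qed.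

Lemma Z3_third_colour (i j x : 'Z_3) : i != j -> x != i -> x != j -> x = - (i + j).
Proof.
by move: i j x; do 3![case=> [[|[|[|]]]] //= ?] => *; apply: val_inj.
Qed.

(** The tactic [ring] does not know that 3 = 0; the witness [z] supplies the multiple of 3 to be
    dropped. *)
Lemma Z3_eq (z x y : 'Z_3) : x - y = 3%:R * z -> x = y.
Proof. by rewrite Z3_three mul0r => /eqP; rewrite subr_eq0 => /eqP. Qed.

(** Certificate form of a linear combination of two hypotheses, leaving an identity for [ring];
    often the second one is 3 = 0. *)
Lemma lincomb2 (p q x y u v a b : 'Z_3) :
  x = y -> u = v -> p - q = a * (x - y) + b * (u - v) -> p = q.
Proof. by move=> -> ->; rewrite !subrr !mulr0 addr0 => /subr0_eq. Qed.

Lemma sum_const_ord N (a : 'Z_3) : N = 1 %[mod 3] -> \sum_(x < N) a = a.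
Proof. by move=> N1; rewrite sumr_const card_ord -mulr_natr Z3_natr1 ?mulr1. Qed.

(** * Colourings without zero-sum triangles *)

Section Gallai.
Variables (T : finType) (c : T -> T -> 'Z_3).
Hypothesis c_sym : forall x y, c x y = c y x.
Hypothesis c_tri : forall x y z, x != y -> y != z -> x != z ->
  c x y + c y z + c x z != 0.

Lemma mono_free i x y z : x != y -> y != z -> x != z ->
  c x y = i -> c x z = i -> c y z != i.
Proof.
move=> xy yz xz e1 e2; apply: contra_neq (c_tri xy yz xz) => e3.
by rewrite e1 e2 e3 -[RHS](mul0r i) -Z3_three; ring.
Qed.

Lemma rainbow_free i j x y z : x != y -> y != z -> x != z ->
  c x y = i -> c x z = j -> c y z != - (i + j).
Proof.
move=> xy yz xz e1 e2; apply: contra_neq (c_tri xy yz xz) => e3.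
by rewrite e1 e2 e3; ring.
Qed.

Lemma mono_card_le2 k (A : {set T}) :
  {in A &, forall x y, x != y -> c x y = k} -> (#|A| <= 2)%N.
Proof.
move=> Ak; rewrite leqNgt; apply/card_gt2P => -[x [y [z [[xA yA zA] [xy yz zx]]]]].
rewrite eq_sym in zx.
have := mono_free xy yz zx (Ak _ _ xA yA xy) (Ak _ _ xA zA zx).
by rewrite (Ak _ _ yA zA yz) eqxx.
Qed.

Variable v : T.
Definition nbhd i : {set T} := [set x | (x != v) && (c v x == i)].

Lemma nbhdP i x : x \in nbhd i -> v != x /\ c v x = i.
Proof. by rewrite inE eq_sym => /andP[? /eqP]. Qed.

Lemma nbhd_colour i x y : x \in nbhd i -> y \in nbhd i -> x != y -> c x y != i.
Proof. by move=> /nbhdP[? ?] /nbhdP[? ?] xy; apply: (@mono_free i v). Qed.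

(** The third colour on xy would make the triangle vxy rainbow. *)
Lemma cross_colour i j x y : i != j -> x \in nbhd i -> y \in nbhd j ->
  c x y = i \/ c x y = j.
Proof.
move=> ij /nbhdP[vx ex] /nbhdP[vy ey].
have xy : x != y by apply: contra_neq ij => exy; rewrite -ex -ey exy.
have := rainbow_free vx xy vy ex ey.
have [|nei] := eqVneq (c x y) i; first by left.
have [|nej] := eqVneq (c x y) j; first by right.
by rewrite (Z3_third_colour ij nei nej) eqxx.
Qed.

Lemma card_split i (A : {set T}) x j : i != j ->
  {in A, forall y, c x y = i \/ c x y = j} ->
  #|A| = (#|[set y in A | c x y == i]| + #|[set y in A | c x y == j]|)%N.
Proof.
move=> ij Aij; rewrite -(cardsID [set y | c x y == i] A); congr (_ + _)%N.
  by apply: eq_card => y; rewrite !inE.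
apply: eq_card => y; rewrite !inE; case: (boolP (y \in A)) => yA; rewrite ?andbF //=.
by case: (Aij _ yA) => ->; rewrite ?eqxx ?andbT ?(negPf ij) // eq_sym ij.
Qed.

(** Inside [nbhd i] colour i is forbidden, so a vertex x sees only two colours there. The vertices
    it sees in colour l span neither i nor l, hence number at most 2: in all 1 + 2 + 2. *)
Lemma nbhd_card_le5 i : (#|nbhd i| <= 5)%N.
Proof.
have [->|[x xA]] := set_0Vmem (nbhd i); first by rewrite cards0.
rewrite (cardsD1 x) xA.
have third (y z : 'Z_3) : y != z -> - (y + z) != y /\ - (y + z) != z.
  by move: y z; do 2![case=> [[|[|[|]]]] //= ?].
pose j := i + 1; pose k := - (i + j).
have ij : i != j by rewrite /j; move: (i) => []; do 3?case.
have [ki kj] := third _ _ ij.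
have cjk : {in nbhd i :\ x, forall y, c x y = j \/ c x y = k}.
  move=> y; rewrite in_setD1 eq_sym => /andP[xy yA].
  have nei := nbhd_colour xA yA xy.
  have [|nej] := eqVneq (c x y) j; first by left.
  by right; apply: Z3_third_colour.
rewrite (card_split _ cjk); last by rewrite eq_sym.
have small l : l != i -> (#|[set y in nbhd i :\ x | c x y == l]| <= 2)%N.
  move=> li; apply: (@mono_card_le2 (- (i + l))) => y z.
  rewrite !inE ![_ == x]eq_sym.
  move=> /andP[/andP[xy yA] /eqP ey] /andP[/andP[xz zA] /eqP ez] yz.
  apply: Z3_third_colour; first by rewrite eq_sym.
    by apply: nbhd_colour yz; rewrite inE.
  exact: (@mono_free l x).
have := small j; have := small k; rewrite ki eq_sym ij => /(_ isT) ? /(_ isT) ?.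
lia.
Qed.

(** Inside [nbhd j], v forbids colour j and any y of [nbhd i] forbids colour i, so one colour
    remains. *)
Lemma all_cross_card_le2 i j : i != j -> nbhd i != set0 ->
  (forall x y, x \in nbhd j -> y \in nbhd i -> c x y = i) -> (#|nbhd j| <= 2)%N.
Proof.
move=> ij /set0Pn[y yA] ci; apply: (@mono_card_le2 (- (i + j))) => x z xA zA xz.
have ne t : t \in nbhd j -> y != t.
  move=> /nbhdP[_ et]; apply: contra_neq ij => e.
  by have [_ <-] := nbhdP yA; rewrite -et e.
apply: Z3_third_colour => //; last exact: nbhd_colour.
by apply: (@mono_free i y); rewrite ?ne // c_sym ci.
Qed.

(* If some x in nbhd j sends colour j into a large nbhd i, then nbhd i is a
   4-cycle of colour j together with two diagonals of the third colour. *)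
Lemma mixed_cross i j x y0 : i != j -> x \in nbhd j -> y0 \in nbhd i ->
  c x y0 = j -> (4 <= #|nbhd i|)%N ->
  (#|nbhd i| <= 4)%N /\
  {in nbhd i, forall y, (2 <= #|[set z in nbhd i | (z != y) && (c y z == j)]|)%N}.
Proof.
move=> ij xA y0A cy0 big.
have ji : j != i by rewrite eq_sym.
have ne y : y \in nbhd i -> x != y.
  move=> /nbhdP[_ et]; apply: contra_neq ij => e.
  by have [_ <-] := nbhdP xA; rewrite -et e.
have cij : {in nbhd i, forall y, c x y = i \/ c x y = j}.
  by move=> y yA; rewrite c_sym; apply: cross_colour.
have cA := card_split ij cij.
set P := [set y in nbhd i | c x y == i] in cA.
set R := [set y in nbhd i | c x y == j] in cA.
have inP y : y \in P -> y \in nbhd i /\ c x y = i.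
  by rewrite /P in_set => /andP[? /eqP].
have inR y : y \in R -> y \in nbhd i /\ c x y = j.
  by rewrite /R in_set => /andP[? /eqP].
(* Between P and R, v forbids colour i and x forbids the third colour. *)
have cPR y z : y \in P -> z \in R -> c y z = j.
  move=> /inP[yA ey] /inR[zA ez].
  have yz : y != z by apply: contra_neq ij => e; rewrite -ey -ez e.
  have nei := nbhd_colour yA zA yz.
  have := rainbow_free (ne _ yA) yz (ne _ zA) ey ez.
  have [//|nej] := eqVneq (c y z) j.
  by rewrite (Z3_third_colour ij nei nej) eqxx.
have y0R : y0 \in R by rewrite inE y0A cy0 eqxx.
have R2 : (#|R| <= 2)%N.
  apply: (@mono_card_le2 (- (i + j))) => y z /inR[yA ey] /inR[zA ez] yz.
  apply: Z3_third_colour (nbhd_colour yA zA yz) _ => //.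
  by apply: (@mono_free j x); rewrite ?ne.
(* By [cPR], y0 sends colour j to all of P and so plays for P the role of x for R. *)
have P2 : (#|P| <= 2)%N.
  apply: (@mono_card_le2 (- (i + j))) => y z yP zP yz.
  have [[yA _] [zA _]] := (inP y yP, inP z zP).
  have neP t : t \in P -> y0 != t.
    move=> /inP[_ et]; apply: contra_neq ij => e.
    by rewrite -et -cy0 e.
  apply: Z3_third_colour (nbhd_colour yA zA yz) _ => //.
  by apply: (@mono_free j y0); rewrite ?neP // c_sym; apply: cPR.
have sub y (B : {set T}) : (2 <= #|B|)%N -> B \subset nbhd i -> y \notin B ->
    {in B, forall z, c y z = j} ->
    (2 <= #|[set z in nbhd i | (z != y) && (c y z == j)]|)%N.
  move=> B2 BA yB By; apply: leq_trans B2 _; apply: subset_leq_card.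
  apply/subsetP => z zB; rewrite inE (subsetP BA) // By // eqxx andbT.
  by apply: contraNneq yB => <-.
have PA : P \subset nbhd i by apply/subsetP => z; rewrite inE => /andP[].
have RA : R \subset nbhd i by apply/subsetP => z; rewrite inE => /andP[].
(* Both classes have exactly 2 elements, and each vertex has the opposite class as j-neighbours. *)
split; first by lia.
move=> y yA; case: (cij y yA) => ey.
  apply: (sub y R) => //; first by lia.
    by rewrite inE ey (negPf ij) andbF.
  by move=> z zR; apply: cPR => //; rewrite inE yA ey eqxx.
apply: (sub y P) => //; first by lia.
  by rewrite inE ey eq_sym (negPf ij) andbF.
by move=> z zP; rewrite c_sym; apply: cPR => //; rewrite inE yA ey eqxx.
Qed.

Lemma mixed_or_le2 i j : i != j -> (4 <= #|nbhd i|)%N -> (3 <= #|nbhd j|)%N ->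
  (#|nbhd i| <= 4)%N /\
  {in nbhd i, forall y, (2 <= #|[set z in nbhd i | (z != y) && (c y z == j)]|)%N}.
Proof.
move=> ij big3 big.
have [/existsP[x /existsP[y /and3P[xj yi /eqP cxy]]]|] :=
  boolP [exists x, exists y, [&& x \in nbhd j, y \in nbhd i & c x y == j]].
  exact: mixed_cross xj yi cxy big3.
rewrite negb_exists => /forallP none.
have : (#|nbhd j| <= 2)%N; last by lia.
apply: (all_cross_card_le2 ij); first by rewrite -card_gt0; lia.
move=> x y xj yi; have := none x; rewrite negb_exists => /forallP/(_ y).
rewrite xj yi /=; case: (cross_colour ij yi xj); rewrite c_sym => -> //.
by rewrite eqxx.
Qed.

(** A vertex y of [nbhd i] would have two j-neighbours and two k-neighbours there, making 5 vertices
    where at most 4 are allowed. *)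
Lemma no_three_large i j k : i != j -> i != k -> j != k ->
  (4 <= #|nbhd i|)%N -> (3 <= #|nbhd j|)%N -> (3 <= #|nbhd k|)%N -> False.
Proof.
move=> ij ik jk bi bj bk.
have [le4 dj] := mixed_or_le2 ij bi bj; have [_ dk] := mixed_or_le2 ik bi bk.
have /set0Pn[y yA] : nbhd i != set0 by rewrite -card_gt0; lia.
have := dj y yA; have := dk y yA.
set K := [set _ in _ | _ && (_ == k)].
set J := [set _ in _ | _ && (_ == j)] => K2 J2.
have dJK : J :&: K = set0.
  apply/setP => z; rewrite !inE; apply/negP => /andP[/and3P[_ _ /eqP e]].
  by rewrite e (negPf jk) !andbF.
have : (#|J :|: K| <= #|nbhd i :\ y|)%N.
  apply/subset_leq_card/subsetP => z; rewrite in_setU in_setD1.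
  by case/orP; rewrite in_set => /and3P[-> ->].
move: le4; rewrite cardsU dJK cards0 (cardsD1 y (nbhd i)) yA; lia.
Qed.

Lemma nbhd_card : #|T| = (#|nbhd 0| + #|nbhd 1| + #|nbhd (-1)|).+1.
Proof.
rewrite -cardsT (cardsD1 v) inE add1n; congr _.+1.
rewrite -(cardsID [set x | c v x == 0]) -addnA; congr (_ + _)%N.
  by apply: eq_card => x; rewrite !inE andbT.
rewrite -(cardsID [set x | c v x == 1]); congr (_ + _)%N.
  apply: eq_card => x; rewrite !inE andbT.
  by case: (c v x) => [[|[|[|]]]] //= ?; rewrite ?andbT ?andbF.
apply: eq_card => x; rewrite !inE andbT.
by case: (c v x) => [[|[|[|]]]] //= ?; rewrite ?andbT ?andbF.
Qed.

(** A neighbourhood of size 5 leaves at most 2 for each other one, for a total of 10. Otherwise all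
    sizes are at most 4, and since 4, 4, 4 is excluded the maximum is 1 + 3 + 4 + 4. *)
Lemma zero_triangle_free_card : (#|T| <= 12)%N.
Proof.
have c5 i j : i != j -> (5 <= #|nbhd i|)%N -> (3 <= #|nbhd j|)%N -> False.
  by move=> ij bi bj; have [] := mixed_or_le2 ij (ltnW bi) bj; lia.
rewrite nbhd_card.
have h0 := nbhd_card_le5 0; have h1 := nbhd_card_le5 1.
have h2 := nbhd_card_le5 (-1).
have := c5 0 1 isT; have := c5 0 (-1) isT; have := c5 1 0 isT.
have := c5 1 (-1) isT; have := c5 (-1) 0 isT; have := c5 (-1) 1 isT.
have := @no_three_large 0 1 (-1) isT isT isT.
by lia.
Qed.

End Gallai.

(** * Regular labelings with nonzero degree D *)

Section RegularLabeling.
Variables (N : nat) (g : 'I_N -> 'I_N -> 'Z_3) (D : 'Z_3).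
Hypothesis g_sym : forall x y, g x y = g y x.
Hypothesis g_diag : forall x, g x x = 0.
Hypothesis g_deg : forall x, \sum_y g x y = D.
Hypothesis N1 : N = 1 %[mod 3].
Hypothesis D_neq0 : D != 0.
Hypothesis g_tri : forall x y z, x != y -> y != z -> x != z ->
  g x y + g y z + g x z != D.

(* Each product over an ordered triple of distinct vertices is counted with its
   three rotations, exactly one of which starts with the smallest vertex. *)
Lemma trace_cube : \sum_a \sum_b \sum_c g a c * g b c * g a b = 0.
Proof.
pose F (a b c : 'I_N) :=
  if (a < b)%N && (a < c)%N then g a c * g b c * g a b else 0.
have rot (f : 'I_N -> 'I_N -> 'I_N -> 'Z_3) :
    \sum_a \sum_b \sum_c f b c a = \sum_a \sum_b \sum_c f a b c.
  by rewrite exchange_big; apply: eq_bigr => b _; rewrite exchange_big.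
transitivity (\sum_a \sum_b \sum_c (F a b c + F b c a + F c a b)).
  apply: eq_bigr => a _; apply: eq_bigr => b _; apply: eq_bigr => c _.
  rewrite /F (g_sym b a) (g_sym c a) (g_sym c b).
  have [->|ab] := eqVneq a b.
    by rewrite g_diag !(mulr0, mul0r) !if_same !addr0.
  have [->|bc] := eqVneq b c.
    by rewrite g_diag !(mulr0, mul0r) !if_same !addr0.
  have [->|ac] := eqVneq a c.
    by rewrite g_diag !(mulr0, mul0r) !if_same !addr0.
  case: ifP => h1; case: ifP => h2; case: ifP => h3;
    try solve [exfalso; move: ab bc ac h1 h2 h3; rewrite -!val_eqE /=; lia]; ring.
under eq_bigr do under eq_bigr do rewrite !big_split.
under eq_bigr do rewrite !big_split.
rewrite !big_split /= (rot (fun a b c => F b c a)) (rot F).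
by apply: (Z3_eq (z := \sum_a \sum_b \sum_c F a b c)); ring.
Qed.

(** As [g] is symmetric, [G2] lists the entries of G^2 and [e] its diagonal. *)
Let e a := \sum_c g a c ^+ 2.
Let G2 a b := \sum_c g a c * g b c.

Lemma D_sqr : D ^+ 2 = 1. Proof. exact: Z3_sqr. Qed.

(* Every triangle sum differs from D by 1 or -1; sum the squares of these
   differences over the triangles containing the edge ab. *)
Lemma codegree a b : a != b -> G2 a b = e a + e b - (g a b + D) ^+ 2.
Proof.
move=> ab.
pose t c := (g a b - D + g a c + g b c) ^+ 2.
have tE : \sum_c t c =
    (g a b - D) ^+ 2 + 4%:R * (g a b - D) * D + e a + e b + 2%:R * G2 a b.
  transitivity (\sum_c ((g a b - D) ^+ 2 + 2%:R * (g a b - D) * g a c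
     + 2%:R * (g a b - D) * g b c + g a c ^+ 2 + g b c ^+ 2
     + 2%:R * (g a c * g b c))).
    by apply: eq_bigr => c _; rewrite /t; ring.
  by rewrite !big_split /= -!mulr_sumr (sum_const_ord _ N1) !g_deg /e /G2; ring.
have t1 : \sum_c t c = 2%:R * (2%:R * g a b - D) ^+ 2 - 1.
  (* Only c = a and c = b can have t c <> 1; both give (2 g a b - D)^2. The constant 1 sums to N =
     1. *)
  transitivity (\sum_c (1 + (t c - 1))).
    by apply: eq_bigr => c _; rewrite addrC subrK.
  rewrite big_split /= (sum_const_ord _ N1) (bigD1 a) //=.
  rewrite (bigD1 b) 1?eq_sym //= big1.
    by rewrite /t !g_diag (g_sym b a); ring.
  move=> c /andP[ca cb]; rewrite /t Z3_sqr ?subrr //.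
  rewrite eq_sym in ca; rewrite eq_sym in cb.
  apply: contra_neq (g_tri ab cb ca) => z.
  by rewrite -[RHS]addr0 -z; ring.
have tt := etrans (esym tE) t1.
apply: (@Z3_eq (G2 a b - 2%:R * g a b ^+ 2 + 4%:R * g a b * D - D ^+ 2)).
by apply: (lincomb2 (a := -1) (b := -1) tt D_sqr); ring.
Qed.

(** Compute the row sum of G^2 twice: regularity gives D^2, and [codegree] expresses it through the
    values of [e]. *)
Lemma sqr_norm_const a : e a = \sum_b e b.
Proof.
have GE : \sum_b G2 a b = D ^+ 2.
  rewrite /G2 exchange_big /= expr2 -[X in X * _](g_deg a) mulr_suml.
  apply: eq_bigr => c _; rewrite -mulr_sumr -(g_deg c); congr (_ * _).
  exact: eq_bigr.
(* At b = a the expression of [codegree] is 2 e a - D^2 while the entry is e a, whence the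
   correction. *)
have : \sum_b G2 a b = \sum_b (e a + e b - (g a b + D) ^+ 2) - e a + D ^+ 2.
  rewrite (bigD1 a) // [X in _ = X - _ + _](bigD1 a) //=.
  under eq_bigr do rewrite codegree 1?eq_sym //.
  by rewrite g_diag; rewrite {1}/G2 -/(e a); ring.
have -> : \sum_b (e a + e b - (g a b + D) ^+ 2) =
    e a + \sum_b e b - (e a + 2%:R * D * D + D ^+ 2).
  rewrite sumrB big_split /= (sum_const_ord _ N1); congr (_ - _).
  rewrite -[in RHS](sum_const_ord (D ^+ 2) N1) -[X in _ * X](g_deg a) mulr_sumr.
  by rewrite /e -!big_split; apply: eq_bigr => b _ /=; ring.
rewrite GE => E.
by apply: (lincomb2 (a := 1) (b := - D ^+ 2) E Z3_three); ring.
Qed.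

(** Multiply [codegree] by g a b and reduce g^3 to g. On summing over b the common norm E cancels,
    leaving -2D = D. *)
Lemma closed_walks3 a : \sum_b G2 a b * g a b = D.
Proof.
set E := \sum_b e b.
transitivity (\sum_b ((2%:R * E - D ^+ 2) * g a b - g a b
                      - 2%:R * D * g a b ^+ 2)).
  apply: eq_bigr => b _; have [<-|ab] := eqVneq a b.
    by rewrite g_diag expr0n !mulr0 !subr0.
  rewrite codegree // !sqr_norm_const -/E.
  by apply: (lincomb2 (a := -1) (b := 0) (Z3_cube (g a b)) Z3_three); ring.
rewrite !sumrB -!mulr_sumr g_deg -/(e a) sqr_norm_const -/E D_sqr.
by apply: (Z3_eq (z := - D)); ring.
Qed.

Lemma no_regular_labeling : False.
Proof.
have : \sum_a \sum_b G2 a b * g a b = D.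
  by rewrite -[RHS](sum_const_ord _ N1); apply: eq_bigr => a _; apply: closed_walks3.
under eq_bigr do under eq_bigr do rewrite mulr_suml.
by rewrite trace_cube => D0; case/eqP: D_neq0.
Qed.

End RegularLabeling.

(** * Label sums inside a vertex set and its complement *)

Section ZeroSumSets.
Variables (T : finType) (h : T -> T -> 'Z_3).

(** Ordered pairs are summed, so for symmetric [h] with zero diagonal each edge counts twice; as 2
    is invertible, vanishing is unaffected. *)
Definition inner_sum (X : {set T}) := \sum_(x in X) \sum_(y in X) h x y.

Hypothesis h_sym : forall x y, h x y = h y x.
Hypothesis h_diag : forall x, h x x = 0.

Lemma sum_setC (X : {set T}) (f : T -> 'Z_3) :
  \sum_(x in ~: X) f x = \sum_x f x - \sum_(x in X) f x.
Proof.
rewrite [X in _ = X - _](bigID (mem X)) /= addrC addrK.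
by apply: eq_bigl => x; rewrite inE.
Qed.

(** Inclusion-exclusion; the degree sum over X enters with coefficient -2 = 1. *)
Lemma inner_sumC (X : {set T}) :
  inner_sum (~: X) =
  \sum_x \sum_y h x y + \sum_(x in X) \sum_y h x y + inner_sum X.
Proof.
rewrite /inner_sum sum_setC.
under eq_bigr do rewrite sum_setC.
under [X in _ - X]eq_bigr do rewrite sum_setC.
have -> : \sum_x (\sum_y h x y - \sum_(y in X) h x y) =
    \sum_x \sum_y h x y - \sum_(x in X) \sum_y h x y.
  rewrite sumrB; congr (_ - _); rewrite exchange_big; apply: eq_bigr => y _.
  by apply: eq_bigr => x _.
rewrite sumrB.
by apply: (Z3_eq (z := - \sum_(x in X) \sum_y h x y)); ring.
Qed.

Lemma inner_sum2 a b : a != b -> inner_sum [set a; b] = - h a b.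
Proof.
move=> ab; rewrite /inner_sum.
have s2 f : \sum_(x in [set a; b]) f x = f a + f b :> 'Z_3.
  by rewrite big_setU1 ?inE // big_set1.
rewrite !s2 !h_diag (h_sym b a).
by apply: (Z3_eq (z := h a b)); ring.
Qed.

Lemma sum_set3 a b c (f : T -> 'Z_3) : a != b -> b != c -> a != c ->
  \sum_(x in [set a; b; c]) f x = f a + f b + f c.
Proof.
move=> ab bc ac; rewrite setUC big_setU1 ?big_setU1 ?big_set1 ?inE //.
  by rewrite addrC.
by rewrite negb_or ![c == _]eq_sym ac.
Qed.

Lemma inner_sum3 a b c : a != b -> b != c -> a != c ->
  inner_sum [set a; b; c] = - (h a b + h b c + h a c).
Proof.
move=> ab bc ac; rewrite /inner_sum !sum_set3 // !h_diag.
rewrite (h_sym b a) (h_sym c a) (h_sym c b).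
by apply: (Z3_eq (z := h a b + h b c + h a c)); ring.
Qed.

End ZeroSumSets.

Lemma zero_sum_co_triple N (h : 'I_N -> 'I_N -> 'Z_3) :
  (12 < N)%N -> N = 1 %[mod 3] ->
  (forall x y, h x y = h y x) -> (forall x, h x x = 0) ->
  exists2 X : {set 'I_N}, #|X| = 3 & inner_sum h (~: X) = 0.
Proof.
move=> N12 N1 h_sym h_diag.
pose d x := \sum_y h x y; pose D := \sum_x d x.
pose g x y := if x == y then 0 else h x y + d x + d y.
have g_sym x y : g x y = g y x.
  by rewrite /g eq_sym; case: eqP => // _; rewrite h_sym addrAC.
have g_diag x : g x x = 0 by rewrite /g eqxx.
have g_deg x : \sum_y g x y = D.
  (* The full sum is d x + N d x + D = 2 d x + D; the term y = x, set to 0 in [g], accounts for 2 d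
     x. *)
  transitivity (\sum_y (h x y + d x + d y) - (d x + d x)).
    rewrite [X in _ = X - _](bigD1 x) //= h_diag add0r addrC addrK.
    rewrite (bigD1 x) //= g_diag add0r; apply: eq_bigr => y yx.
    by rewrite /g eq_sym (negPf yx).
  by rewrite !big_split /= sum_const_ord // -/(d x) -/D addrC addrK.
have [/existsP[a /existsP[b /existsP[c /and4P[ab bc ac /eqP e]]]]|none] :=
  boolP [exists a, exists b, exists c,
    [&& a != b, b != c, a != c & g a b + g b c + g a c == D]].
  exists [set a; b; c].
    by rewrite setUC cardsU1 cards2 ab !inE negb_or ![c == _]eq_sym ac bc.
  rewrite inner_sumC // inner_sum3 // sum_set3 //.
  move: e; rewrite /g (negPf ab) (negPf bc) (negPf ac) => e.
  apply: (lincomb2 (a := -1) (b := d a + d b + d c) e Z3_three); rewrite /D /d.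
  by ring.
have g_tri x y z : x != y -> y != z -> x != z -> g x y + g y z + g x z != D.
  move=> xy yz xz; apply: contraNneq none => e.
  apply/existsP; exists x; apply/existsP; exists y; apply/existsP; exists z.
  by rewrite xy yz xz e eqxx.
have [D0|D0] := eqVneq D 0; last first.
  by case: (no_regular_labeling g_sym g_diag g_deg N1 D0 g_tri).
(* Any vertex serves as base point; with D = 0, [g_tri] says that no triangle has sum 0. *)
have := @zero_triangle_free_card _ g g_sym _ (Ordinal (ltnW (ltnW N12))).
rewrite card_ord leqNgt N12 => /(_ _)/negP[] //.
by move=> x y z xy yz xz; rewrite -D0; apply: g_tri.
Qed.

(** * Copies of K_n as vertex sets *)

(** The default 0 discards the singletons [set x; x], where [w] is arbitrary. *)
Definition edge_label N (w : {set complete_graph N} -> 'Z_3) (x y : 'I_N) : 'Z_3 :=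
  if x == y then 0 else w [set x; y].

Lemma edge_label_sym N (w : {set complete_graph N} -> 'Z_3) x y :
  edge_label w x y = edge_label w y x.
Proof. by rewrite /edge_label eq_sym setUC. Qed.

Lemma edge_label_diag N (w : {set complete_graph N} -> 'Z_3) x :
  edge_label w x x = 0.
Proof. by rewrite /edge_label eqxx. Qed.

Definition inner_edges N (V : {set complete_graph N}) :
    {set {set complete_graph N}} :=
  [set e in edges (complete_graph N) | e \subset V].

Lemma complete_edgeP N (e : {set complete_graph N}) :
  reflect (exists x y : 'I_N, x != y /\ e = [set x; y])
    (e \in edges (complete_graph N)).
Proof.
rewrite in_set; apply: (iffP existsP).
  move=> [x /existsP[y /andP[xy /eqP ->]]].
  by exists x, y.
move=> [x [y [xy ->]]].
by exists x; apply/existsP; exists y; rewrite eqxx andbT.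
Qed.

Lemma inner_sum_edges N (w : {set complete_graph N} -> 'Z_3) (V : {set 'I_N}) :
  inner_sum (edge_label w) V = (\sum_(e in inner_edges V) w e) *+ 2.
Proof.
rewrite /inner_sum pair_big /=.
transitivity (\sum_(p : 'I_N * 'I_N | [&& p.1 \in V, p.2 \in V & p.1 != p.2])
   w [set p.1; p.2]).
  rewrite big_mkcond [RHS]big_mkcond; apply: eq_bigr => -[x y] _ /=.
  by rewrite /edge_label; case: (x \in V); case: (y \in V); case: eqP.
(* Group the ordered pairs by their underlying edge; each fibre is {(x, y), (y, x)}. *)
rewrite (partition_big
  (fun p : 'I_N * 'I_N => [set p.1; p.2] : {set complete_graph N})
  (fun e => e \in inner_edges V)) => [|[x y] /and3P[xV yV xy]]; last first.
  rewrite in_set; apply/andP; split; first by apply/complete_edgeP; exists x, y.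
  by apply/subsetP => z /set2P[] ->.
rewrite -sumrMnl; apply: eq_bigr => e; rewrite in_set.
move=> /andP[/complete_edgeP[x [y [xy ->]]] sV].
rewrite (eq_bigr (fun=> w [set x; y])) => [|p /andP[_ /eqP ->]] //.
have xyV : (x \in V) && (y \in V).
  by rewrite !(subsetP sV) // ?set21 ?set22.
rewrite sumr_const (_ : #|_| = 2) // -[RHS](_ : #|[set (x, y); (y, x)]| = 2).
  apply: eq_card => -[a b]; rewrite !inE /= !xpair_eqE.
  apply/andP/orP => [[/and3P[_ _ ab] /eqP E]|].
    have := set21 a b; have := set22 a b; rewrite E !inE.
    move=> /orP[]/eqP eb /orP[]/eqP ea; move: ab; rewrite ea eb !eqxx //; auto.
  case=> /andP[/eqP -> /eqP ->]; case/andP: xyV => -> ->; first by rewrite xy.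
  by rewrite eq_sym xy setUC.
by rewrite cards2 xpair_eqE (negPf xy).
Qed.

Lemma image_complete_edges n N (f : 'I_n -> 'I_N) : injective f ->
  [set [set f x | x in e : {set 'I_n}] | e in edges (complete_graph n)] =
  inner_edges (f @: setT).
Proof.
move=> f_inj; apply/setP => e; rewrite [RHS]inE; apply/imsetP/andP.
  case=> e' /complete_edgeP[a [b [ab ->]]] ->; split.
    by apply/complete_edgeP; exists (f a), (f b);
      rewrite (inj_eq f_inj) imsetU1 imset_set1.
  by apply: imsetS; apply: subsetT.
case=> /complete_edgeP[x [y [xy ->]]] /subsetP s.
have /imsetP[a _ ea] := s _ (set21 x y); have /imsetP[b _ eb] := s _ (set22 x y).
exists [set a; b]; last by rewrite imsetU1 imset_set1 -ea -eb.
apply/complete_edgeP; exists a, b; split=> //.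
by apply: contra_neq xy => ab; rewrite ea eb ab.
Qed.

(** A copy of K_n amounts to an n-set with all edges inside it, and doubling the label sum is
    harmless mod 3. *)
Lemma zero_sum_arrow_complete n N :
  zero_sum_arrow (complete_graph n) N <->
  forall w : {set complete_graph N} -> 'Z_3,
    exists V : {set 'I_N}, #|V| = n /\ inner_sum (edge_label w) V = 0.
Proof.
split=> H w.
  have [V [E [[_ [f [f_inj fV fE]]] s0]]] := H w.
  exists V; split; first by rewrite -fV card_imset // cardsT card_ord.
  rewrite inner_sum_edges -fV -image_complete_edges // fE s0 ?mul0rn //.
have [V [cV s0]] := H w.
pose f (i : 'I_n) : 'I_N := enum_val (cast_ord (esym cV) i).
have f_inj : injective f by move=> i j /enum_val_inj/cast_ord_inj.
have fV : f @: setT = V.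
  apply/eqP; rewrite eqEcard card_imset // cardsT card_ord cV leqnn andbT.
  by apply/subsetP => _ /imsetP[i _ ->]; apply: enum_valP.
exists V, (inner_edges V : {set {set complete_graph N}}); split.
  split.
    by split; [apply/subsetP=> e|move=> e]; rewrite in_set => /andP[].
  by exists f; split=> //; rewrite -fV; apply: image_complete_edges.
move: s0; rewrite inner_sum_edges => s0.
apply: (lincomb2 (a := -1) (b := \sum_(e in inner_edges V) w e) s0 Z3_three).
by ring.
Qed.

(** Restrict the labeling to the first M vertices. This reduces the lower bound to K_(n+2). *)
Lemma zero_sum_arrow_complete_mono n M N : (M <= N)%N ->
  zero_sum_arrow (complete_graph n) M -> zero_sum_arrow (complete_graph n) N.
Proof.
move=> MN /zero_sum_arrow_complete H; apply/zero_sum_arrow_complete => w.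
pose f : 'I_M -> 'I_N := widen_ord MN.
have f_inj : injective f by move=> x y /(congr1 val) e; apply: val_inj.
have [V [cV s0]] := H (fun e => w [set f x | x in e : {set 'I_M}]).
exists (f @: V); split; first by rewrite card_imset.
rewrite -[RHS]s0 /inner_sum big_imset => [|x y _ _ /f_inj //].
apply: eq_bigr => x _; rewrite big_imset => [|? ? _ _ /f_inj //].
by apply: eq_bigr => y _; rewrite /edge_label (inj_eq f_inj) imsetU1 imset_set1.
Qed.

(** * The lower bound labeling *)

(* Parts of size 2, 2 and N - 4: all three sizes are 2 mod 3 when 3 %| N, so
   labeling edges 1 inside parts and -1 across makes all degrees vanish. *)
Definition part (x : nat) : nat := ((1 < x) + (3 < x))%N.

Definition part_label N (e : {set complete_graph N}) : 'Z_3 :=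
  if [forall x in e, forall y in e,
        part (val (x : 'I_N)) == part (val (y : 'I_N))] then 1 else -1.

Lemma part_label_edge N (x y : 'I_N) : x != y ->
  edge_label (@part_label N) x y = if part x == part y then 1 else -1.
Proof.
move=> xy; rewrite /edge_label (negPf xy) /part_label; congr (if _ then _ else _).
apply/forall_inP/eqP => [H|e u].
  by apply/eqP; apply: (forall_inP (H x (set21 _ _))); apply: set22.
by case/set2P=> ->; apply/forall_inP => v /set2P[] ->; rewrite ?e.
Qed.

(** With all part sizes 2 mod 3, counting x as its own neighbour gives 2 - 2 - 2 = 1, and removing x
    subtracts 1. *)
Lemma part_label_degree N (x : 'I_N) : (4 <= N)%N -> (3 %| N)%N ->
  \sum_y edge_label (@part_label N) x y = 0.
Proof.
move=> N4 N3.
transitivity (\sum_(y < N) (if part x == part y then 1 else -1 : 'Z_3) - 1).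
  rewrite [X in _ = X - _](bigD1 x) //= eqxx [in RHS]addrC addrK.
  rewrite (bigD1 x) //= {1}/edge_label eqxx add0r; apply: eq_bigr => y yx.
  by rewrite part_label_edge // eq_sym.
move: (x : nat) N4 N3 => {}x; case: N => [|[|[|[|m]]]] // _ m3.
(* The first four vertices form the two small parts; the other m = N - 4 all lie in part 2. *)
rewrite !big_ord_recl /= (eq_bigr (fun=> if part x == 2%N then 1 else -1)) //.
rewrite sumr_const card_ord.
have m2 : m%:R = -1 :> 'Z_3.
  have : m.+2%:R = 1 :> 'Z_3 by apply: Z3_natr1; lia.
  rewrite -(addn2 m) natrD => m1.
  by apply: (lincomb2 (a := 1) (b := 0) m1 Z3_three); ring.
rewrite -mulr_natr m2 /part.
by case: (1 < x)%N; case: (3 < x)%N; apply: val_inj.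
Qed.

Local Close Scope ring_scope.

Theorem theorem1p2 (n : nat) (hn : 10 <= n) (hmod : n = 1 %[mod 3]) :
  is_zero_sum_ramsey (complete_graph n) (n + 3).
Proof.
split=> [|M arrM].
  apply/zero_sum_arrow_complete => w.
  have [X X3 s0] : exists2 X : {set 'I_(n + 3)},
      #|X| = 3 & (inner_sum (edge_label w) (~: X) = 0)%R.
    (* Here n >= 10 is used: n + 3 must exceed 12. *)
    apply: zero_sum_co_triple; [lia|by rewrite modnDr| |].
      exact: edge_label_sym.
    exact: edge_label_diag.
  by exists (~: X); rewrite cardsCs setCK card_ord X3 addnK.
rewrite leqNgt; apply/negP => ltM.
have {arrM} : zero_sum_arrow (complete_graph n) (n + 2).
  by apply: zero_sum_arrow_complete_mono arrM; lia.
move/zero_sum_arrow_complete => /(_ (@part_label _)) [V [cV]].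
have /eqP/cards2P[a [b [ab eV]]] : #|~: V| = 2.
  by rewrite cardsCs setCK card_ord cV addKn.
rewrite -[V]setCK eV inner_sumC; last exact: edge_label_sym.
rewrite inner_sum2 //; [|exact: edge_label_sym|exact: edge_label_diag].
(* The degree lemma applies because n = 1 mod 3 makes n + 2 a multiple of 3. *)
have d0 x : (\sum_y edge_label (@part_label (n + 2)) x y = 0)%R.
  by apply: part_label_degree; lia.
rewrite !big1 ?add0r // part_label_edge //.
by case: ifP.
Qed.
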